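(* Let $(n_1,n_2,a_1,a_2,a_3)\in \mathbb{N}^5$ be a solution to the Diophantine equation $$F_{n_1} + F_{n_2} = 2^{a_1} + 2^{a_2} + 2^{a_3}$$ such that $n_1 \geq n_2 \geq 0$ and $a_1 \geq a_2 \geq a_3 \geq 0$. Then $n_1 \leq 18$ and $a_1 \leq 11$. In particular, this equation has exactly $78$ solutions (with $n_1 \geq n_2 \geq 0$ and $a_1 \geq a_2 \geq a_3 \geq 0$).
   Context: $F_k$ denotes the $k$-th Fibonacci number: $F_0=0$, $F_1=1$, $F_{k+2}=F_{k+1}+F_k$ for $k\geq 0$. Here $\mathbb{N}$ includes $0$. *)

(* Defs.v *)
From mathcomp Require Import all_boot.
Set Implicit Arguments. Unset Strict Implicit. Unset Printing Implicit Defensive.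

Fixpoint fib (n : nat) : nat :=
  match n with
  | 0 => 0
  | 1 => 1
  | (m.+1 as k).+1 => fib k + fib m
  end.

Definition is_sol (n1 n2 a1 a2 a3 : nat) : bool :=
  [&& n2 <= n1, a3 <= a2, a2 <= a1 & fib n1 + fib n2 == 2 ^ a1 + 2 ^ a2 + 2 ^ a3].

(* Main.v *)
(** The bound [a1 <= 12] is obtained by local methods only, without linear forms
    in logarithms.  Suppose [a1 >= 13], keep the exponents below 13 in a constant
    [c] and write the others as [13 + a'], so that
    [F n1 + F n2 = c + sum 8192 * 2 ^ a'].  The threshold 13 is chosen because
    F_19 + F_(-8) = 2^12 + 2^5 + 2^5: congruences cannot see the sign of an index,
    so they cannot exclude [a1 = 12].  For a well chosen modulus, Fibonacci numbers
    and powers of 2 both have periods dividing a smooth number; the residues of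
    [n1], [n2] and the [a'] modulo slowly growing smooth numbers are sieved with
    such moduli until none survives.  What remains is a finite check. *)
Require Import Defs.
From mathcomp Require Import all_boot.
From mathcomp Require Import zify.
From Stdlib Require Import NArith Lia.

(** * Addition formula and transfer of Fibonacci numbers to binary integers *)

Lemma fib_add m n : fib (m + n).+1 = fib m.+1 * fib n.+1 + fib m * fib n.
Proof.
elim/ltn_ind: m => -[|[|m]] IH //; first by rewrite /= mul1n addn0.
  by rewrite /= !addn0 !mul1n.
have e k : fib k.+2 = fib k.+1 + fib k by [].
rewrite !addSn e -addSn (IH m.+1) // (IH m) // !e.
nia.
Qed.

Open Scope N_scope.

(** Binary integers make the large sieve computation feasible by [vm_compute]. *)
Definition F (n : N) : N := N.of_nat (fib (N.to_nat n)).

Lemma FE n : N.of_nat (fib n) = F (N.of_nat n).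
Proof. by rewrite /F Nat2N.id. Qed.

Lemma F_succ_add m n : F (m + n + 1) = F (m + 1) * F (n + 1) + F m * F n.
Proof.
have e k l : N.to_nat (k + l) = (N.to_nat k + N.to_nat l)%nat.
  exact: N2Nat.inj_add.
rewrite /F !e -!Nat2N.inj_mul -Nat2N.inj_add; congr N.of_nat.
by rewrite !addn1 fib_add.
Qed.

(** * Fast modular evaluation of Fibonacci numbers and powers of 2 *)

Lemma modN_add M x y x' y' :
  x mod M = x' mod M -> y mod M = y' mod M -> (x + y) mod M = (x' + y') mod M.
Proof. by move=> hx hy; rewrite N.Div0.add_mod hx hy -N.Div0.add_mod. Qed.

Lemma modN_mul M x y x' y' :
  x mod M = x' mod M -> y mod M = y' mod M -> (x * y) mod M = (x' * y') mod M.
Proof. by move=> hx hy; rewrite N.Div0.mul_mod hx hy -N.Div0.mul_mod. Qed.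

(** [fibm M p] is the pair of [F (p - 1)] and [F p] modulo [M]. *)
Fixpoint fibm (M : N) (p : positive) : N * N :=
  match p with
  | xH => (0, 1 mod M)
  | xO p' => let: (a, b) := fibm M p' in
      ((a * a + b * b) mod M, (b * (a + a + b)) mod M)
  | xI p' => let: (a, b) := fibm M p' in
      let e := b * (a + a + b) in (e mod M, (a * a + b * b + e) mod M)
  end.

(** The addition formula gives the doubling identities [F (2q - 1) = F (q - 1)^2 + F q^2] and
    [F (2q) = F q * (2 F (q - 1) + F q)], which match the recursion on binary digits. *)
Lemma fibmP M p : fibm M p = (F (N.pos p - 1) mod M, F (N.pos p) mod M).
Proof.
have dbl q : F (N.pos (xO q) - 1) = F (N.pos q - 1) * F (N.pos q - 1)
      + F (N.pos q) * F (N.pos q)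
   /\ F (N.pos (xO q)) =
      F (N.pos q) * (F (N.pos q - 1) + F (N.pos q - 1) + F (N.pos q)).
  move: (F_succ_add (N.pos q - 1) (N.pos q - 1)).
  move: (F_succ_add (N.pos q) (N.pos q - 1)).
  move: (F_succ_add (N.pos q - 1) 1).
  have -> : N.pos q - 1 + 1 + 1 = N.pos q + 1 by lia.
  have -> : N.pos q - 1 + 1 = N.pos q by lia.
  have -> : N.pos q - 1 + (N.pos q - 1) + 1 = N.pos (xO q) - 1 by lia.
  have -> : N.pos q + (N.pos q - 1) + 1 = N.pos (xO q) by lia.
  have -> : F (1 + 1) = 1 by [].
  have -> : F 1 = 1 by [].
  nia.
have mm x : x mod M mod M = x mod M by rewrite N.Div0.mod_mod.
elim: p => [p IH|p IH|//] /=; last first.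
  have [-> ->] := dbl p; rewrite IH; congr (_, _).
    by apply: modN_add; apply: modN_mul.
  by do !(apply: modN_mul => // || apply: modN_add => //).
have [e1 e2] := dbl p; rewrite IH.
have e3 : F (N.pos p~1) = F (N.pos p~0 - 1) + F (N.pos p~0).
  move: (F_succ_add (N.pos p~0 - 1) 1).
  have -> : N.pos p~0 - 1 + 1 + 1 = N.pos p~1 by lia.
  have -> : N.pos p~0 - 1 + 1 = N.pos p~0 by lia.
  have -> : F (1 + 1) = 1 by [].
  have -> : F 1 = 1 by [].
  lia.
rewrite e3 e1 e2; congr (_, _).
  by do !(apply: modN_mul => // || apply: modN_add => //).
by do !(apply: modN_mul => // || apply: modN_add => //).
Qed.

Definition fib_mod (M n : N) : N := if n is N.pos p then (fibm M p).2 else 0.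

Lemma fib_modE M n : fib_mod M n = F n mod M.
Proof. by case: n => [|p]; rewrite /fib_mod ?fibmP ?N.Div0.mod_0_l. Qed.

Fixpoint pow2m (M : N) (p : positive) : N :=
  match p with
  | xH => 2 mod M
  | xO p' => let a := pow2m M p' in (a * a) mod M
  | xI p' => let a := pow2m M p' in (2 * (a * a)) mod M
  end.

Definition pow2_mod (M n : N) : N := if n is N.pos p then pow2m M p else 1 mod M.

Lemma pow2_modE M n : pow2_mod M n = 2 ^ n mod M.
Proof.
case: n => // p; rewrite /pow2_mod.
elim: p => [p IH|p IH|] //.
  rewrite -[pow2m _ _]/((2 * (pow2m M p * pow2m M p)) mod M) IH.
  have -> : 2 ^ N.pos p~1 = 2 * (2 ^ N.pos p * 2 ^ N.pos p).
    by rewrite -N.pow_add_r -N.pow_succ_r'; congr (2 ^ _); lia.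
  by apply: modN_mul => //; apply: modN_mul; rewrite N.Div0.mod_mod.
rewrite -[pow2m _ _]/((pow2m M p * pow2m M p) mod M) IH.
have -> : 2 ^ N.pos p~0 = 2 ^ N.pos p * 2 ^ N.pos p.
  by rewrite -N.pow_add_r; congr (2 ^ _); lia.
by apply: modN_mul; rewrite N.Div0.mod_mod.
Qed.

(** * Certified periods modulo [M] *)

Lemma period_mod (M L : N) (f : N -> N) :
  (forall n, f (n + L) mod M = f n mod M) -> forall n, f (n mod L) mod M = f n mod M.
Proof.
move=> fL n; rewrite {2}(N.Div0.div_mod n L) N.add_comm.
elim/N.peano_ind: (n / L) => [|k IH]; first by rewrite N.mul_0_r N.add_0_r.
by rewrite N.mul_succ_r N.add_assoc fL.
Qed.

Definition fib_period (M L : N) : bool :=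
  if L is N.pos p then
    let: (a, b) := fibm M p in N.eqb a (1 mod M) && N.eqb b 0
  else false.

(** By the addition formula [F (n + L) = F (n + 1) * F L + F n * F (L - 1)], so it is enough that
    [F L] is 0 and [F (L - 1)] is 1 modulo [M]. *)
Lemma fib_periodP M L : fib_period M L -> forall n, F (n mod L) mod M = F n mod M.
Proof.
case: L => // p; rewrite /fib_period fibmP => /andP[/N.eqb_eq h1 /N.eqb_eq h0].
apply: period_mod => n.
have -> : n + N.pos p = n + (N.pos p - 1) + 1 by lia.
have e : N.pos p - 1 + 1 = N.pos p by lia.
rewrite F_succ_add e -{2}[F n]N.add_0_l -{2}[F n]N.mul_1_r -(N.mul_0_r (F (n + 1))).
by apply: modN_add; apply: modN_mul; rewrite // h0 N.Div0.mod_0_l.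
Qed.

(** The factor [A] allows even moduli: with [A = 8192] the sequence [A * 2 ^ a] is purely periodic
    modulo [M] as soon as the 2-part of [M] divides [2 ^ 13]. *)
Definition pow2_period (A M L : N) : bool := N.eqb ((A * pow2_mod M L) mod M) (A mod M).

Lemma pow2_periodP A M L : pow2_period A M L ->
  forall n, (A * 2 ^ (n mod L)) mod M = (A * 2 ^ n) mod M.
Proof.
rewrite /pow2_period pow2_modE N.Div0.mul_mod_idemp_r => /N.eqb_eq h.
apply: (@period_mod M L (fun n => A * 2 ^ n)) => n.
rewrite N.pow_add_r [2 ^ n * _]N.mul_comm N.mul_assoc.
exact: modN_mul.
Qed.

(** * The sieve on residues of indices and exponents *)

Definition lifts (L : N) (q : nat) (x : N) : seq N :=
  [seq x + L * N.of_nat i | i <- iota 0 q].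

Lemma mem_lifts L q n : L <> 0 -> (0 < q)%nat ->
  n mod (L * N.of_nat q) \in lifts L q (n mod L).
Proof.
move=> L0 q0; rewrite N.mod_mul_r; [|by []|lia].
apply/mapP; exists (N.to_nat ((n / L) mod N.of_nat q)); last by rewrite N2Nat.id.
have : (n / L) mod N.of_nat q < N.of_nat q by apply: N.mod_upper_bound; lia.
rewrite mem_iota; move: (_ mod _) => k; lia.
Qed.

Definition addm (M x y : N) : N :=
  let s := x + y in if N.ltb s M then s else s - M.

Lemma addm_mod M x y : M <> 0 -> addm M (x mod M) (y mod M) = (x + y) mod M.
Proof.
move=> M0; rewrite N.Div0.add_mod /addm.
have [hx hy] := (N.mod_upper_bound x M M0, N.mod_upper_bound y M M0).
move: (x mod M) (y mod M) hx hy => {}x {}y hx hy.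
case: N.ltb_spec => h; first by rewrite N.mod_small.
(* A sum of two residues is below [2 * M], so the quotient is 1 here. *)
by apply: (N.mod_unique _ _ 1); lia.
Qed.

(** Tabulates a function of period [P] when [P] is small. *)
Definition memo (P : N) (f : N -> N) : N -> N :=
  if N.ltb P 2000 then
    let t := [seq f (N.of_nat i) | i <- iota 0 (N.to_nat P)] in
    fun x => nth 0 t (N.to_nat (x mod P))
  else fun x => f (x mod P).

Lemma memoE P f x : P <> 0 -> f (x mod P) = f x -> memo P f x = f x.
Proof.
move=> P0 fP; rewrite /memo; case: N.ltb => //.
have h := N.mod_upper_bound x P P0.
have k : (N.to_nat (x mod P) < N.to_nat P)%nat by move: (x mod P) h => y; lia.
by rewrite (nth_map 0%nat) ?size_iota // nth_iota // add0n N2Nat.id.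
Qed.

(** The constant [c], the residues of [n1] and [n2], and those of the exponents. *)
Definition state := (N * (N * N) * seq N)%type.

Definition residues (L1 L2 c n1 n2 : N) (s : seq N) : state :=
  (c, (n1 mod L1, n2 mod L1), [seq a mod L2 | a <- s]).

Section Sieve.
Variable A : N.

Definition rhs (c : N) (s : seq N) : N := foldr (fun a t => A * 2 ^ a + t) c s.

Section Refine.
Variables (M : N) (ff pf : N -> N).
Hypothesis M0 : M <> 0.
Hypothesis ffE : forall n, ff n = F n mod M.
Hypothesis pfE : forall a, pf a = (A * 2 ^ a) mod M.

(** Each tuple of lifted exponents carries its right-hand side modulo [M], so that [refine] computes
    these sums once for all pairs of indices. *)
Fixpoint pow_sums (L : N) (r : nat) (c : N) (s : seq N) : seq (seq N * N) :=
  if s is a :: s' then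
    let us := pow_sums L r c s' in
    flatten [seq let e := pf b in
                 [seq (b :: u.1, addm M e u.2) | u <- us] | b <- lifts L r a]
  else [:: ([::], c mod M)].

Lemma mem_pow_sums L r c s :
  L <> 0 -> (0 < r)%nat -> pow2_period A M (L * N.of_nat r) ->
  ([seq a mod (L * N.of_nat r) | a <- s], rhs c s mod M)
    \in pow_sums L r c [seq a mod L | a <- s].
Proof.
move=> L0 r0 per; elim: s => [|a s IH] /=; first exact: mem_head.
apply/flatten_mapP; exists (a mod (L * N.of_nat r)); first exact: mem_lifts.
apply/mapP; eexists; first exact: IH.
by rewrite /= pfE (pow2_periodP _ _ _ per) addm_mod.
Qed.

Definition refine (q r : nat) (L1 L2 : N) (st : state) : seq state :=
  let: (c, (n1, n2), s) := st in
  let us := pow_sums L2 r c s in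
  let ys := [seq (y, ff y) | y <- lifts L1 q n2] in
  flatten [seq let fx := ff x in
    flatten [seq let v := addm M fx y.2 in
      [seq (c, (x, y.1), u.1) | u <- us & N.eqb v u.2] | y <- ys]
    | x <- lifts L1 q n1].

Lemma mem_refine q r L1 L2 c n1 n2 s :
  L1 <> 0 -> L2 <> 0 -> (0 < q)%nat -> (0 < r)%nat ->
  fib_period M (L1 * N.of_nat q) -> pow2_period A M (L2 * N.of_nat r) ->
  F n1 + F n2 = rhs c s ->
  residues (L1 * N.of_nat q) (L2 * N.of_nat r) c n1 n2 s
    \in refine q r L1 L2 (residues L1 L2 c n1 n2 s).
Proof.
move=> L10 L20 q0 r0 fper pper e; set L1' := L1 * _; set L2' := L2 * _.
apply/flatten_mapP; exists (n1 mod L1'); first exact: mem_lifts.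
apply/flatten_mapP; exists (n2 mod L1', ff (n2 mod L1')).
  by apply: map_f; apply: mem_lifts.
apply/mapP; exists ([seq a mod L2' | a <- s], rhs c s mod M) => //.
rewrite mem_filter mem_pow_sums // andbT; apply/N.eqb_eq.
by rewrite /= -e !ffE !(fib_periodP _ _ fper) addm_mod.
Qed.

End Refine.

(** A level multiplies the moduli of the indices and of the exponents by
    [fib_factor] and [pow_factor], then filters by the equation modulo [modulus],
    for which [fib_per] and [pow_per] are periods of [F n] and [A * 2 ^ a]. *)
Record level := Level
  { fib_factor : nat; pow_factor : nat; modulus : N; fib_per : N; pow_per : N }.

(** The side conditions of every level are checked along the way, so the schedule is untrusted data:
    a wrong period yields [false]. *)
Fixpoint sieve (ls : seq level) (L1 L2 : N) (S : seq state) : bool :=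
  if ls is Level q r M P Q :: ls' then
    let L1' := L1 * N.of_nat q in
    let L2' := L2 * N.of_nat r in
    let ff := memo P (fib_mod M) in
    let pf := memo Q (fun a => (A * pow2_mod M a) mod M) in
    [&& 0 < q, 0 < r & ~~ N.eqb M 0]%nat &&
    [&& ~~ N.eqb P 0, fib_period M P & fib_period M L1'] &&
    [&& ~~ N.eqb Q 0, pow2_period A M Q & pow2_period A M L2'] &&
    sieve ls' L1' L2' (flatten [seq refine M ff pf q r L1 L2 s | s <- S])
  else nilp S.

(** The residues of a solution survive every level by [mem_refine], which contradicts the emptiness
    of the final list. *)
Lemma sieveP ls L1 L2 S c n1 n2 s : L1 <> 0 -> L2 <> 0 -> sieve ls L1 L2 S ->
  residues L1 L2 c n1 n2 s \in S -> F n1 + F n2 <> rhs c s.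
Proof.
elim: ls L1 L2 S => [|[q r M P Q] ls IH] L1 L2 S L10 L20; first by case: S.
case/andP=> /andP[/andP[/and3P[q0 r0 /negbTE/N.eqb_neq M0] /and3P[/negbTE/N.eqb_neq P0 fP fL]]].
case/and3P=> /negbTE/N.eqb_neq Q0 pQ pL sv inS e.
apply: (IH _ _ _ _ _ sv _ e); try lia.
apply/flatten_mapP; eexists; first exact: inS.
apply: mem_refine => // n.
  by rewrite memoE ?fib_modE // (fib_periodP _ _ fP).
have pE a : (A * pow2_mod M a) mod M = (A * 2 ^ a) mod M.
  by rewrite pow2_modE N.Div0.mul_mod_idemp_r.
by rewrite memoE ?pE // (pow2_periodP _ _ _ pQ).
Qed.

End Sieve.

(** * The sieve run that excludes exponents above 12 *)

Arguments Level (_ _)%_nat_scope (_ _ _)%_N_scope.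

(** Found by a computer search keeping the number of surviving residues small. *)
Definition schedule : seq level :=
  [:: Level 24 2 48 24 2;
      Level 1 3 9 24 6;
      Level 2 1 224 48 3;
      Level 3 3 513 72 18;
      Level 1 4 17 36 8;
      Level 3 1 109 108 36;
      Level 5 1 1205 240 24;
      Level 1 5 1991 90 180;
      Level 5 1 3775 100 60;
      Level 1 5 401 200 200;
      Level 4 2 1601 160 400;
      Level 1 1 128 192 1;
      Level 1 1 4801 4800 1200;
      Level 8 2 9601 3200 2400;
      Level 1 1 1024 1536 1;
      Level 1 1 115201 115200 225;
      Level 2 16 641 640 64;
      Level 1 1 769 192 384;
      Level 1 1 2048 3072 1;
      Level 1 1 7681 7680 3840;
      Level 4 2 61441 61440 5120;
      Level 1 1 8192 12288 1].

Definition small_sums : seq N :=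
  flatten [seq [seq 2 ^ N.of_nat i + 2 ^ N.of_nat j | j <- iota 0 i.+1]
    | i <- iota 0 13].

(** The three groups have zero, one or two exponents below 13, absorbed in [c]. Modulo 1 every
    residue is 0, so nothing is assumed about the indices and the other exponents. *)
Definition start : seq state :=
  residues 1 1 0 0 0 (nseq 3 0) ::
    [seq residues 1 1 (2 ^ N.of_nat i) 0 0 (nseq 2 0) | i <- iota 0 13] ++
    [seq residues 1 1 c 0 0 (nseq 1 0) | c <- small_sums].

Lemma sieve_start : sieve 8192 schedule 1 1 start.
Proof. by vm_compute. Qed.

Lemma pow2E a : N.of_nat (expn 2 a) = 2 ^ N.of_nat a.
Proof.
elim: a => // a IH; rewrite expnS Nat2N.inj_succ N.pow_succ_r' -IH; lia.
Qed.

Lemma pow2_large a : (12 < a)%nat -> 2 ^ N.of_nat a = 8192 * 2 ^ N.of_nat (a - 13).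
Proof.
move=> h; rewrite -[8192]/(2 ^ 13) -N.pow_add_r; congr (2 ^ _); lia.
Qed.

Lemma residues1 c n1 n2 s : residues 1 1 c n1 n2 s = residues 1 1 c 0 0 (nseq (size s) 0).
Proof.
rewrite /residues !N.mod_1_r; congr (_, _).
by elim: s => //= a s ->; rewrite N.mod_1_r.
Qed.

Lemma no_sum c n1 n2 s : residues 1 1 c 0 0 (nseq (size s) 0) \in start ->
  F n1 + F n2 <> rhs 8192 c s.
Proof.
by rewrite -(residues1 c n1 n2); apply: (sieveP _ _ _ _ _ _ _ _ _ _ _ sieve_start).
Qed.

Close Scope N_scope.

Lemma no_large_sol n1 n2 a1 a2 a3 : is_sol n1 n2 a1 a2 a3 -> a1 <= 12.
Proof.
case/and4P=> _ h32 h21 /eqP/(congr1 N.of_nat).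
rewrite !Nat2N.inj_add !FE !pow2E leqNgt => e; apply/negP => h1.
have mem_pow a : a <= 12 -> a \in iota 0 13 by rewrite mem_iota.
move: e; rewrite (pow2_large _ h1).
(* As the exponents decrease, the cases are three, two or one of them above 12. *)
have [h3|h3] := ltnP 12 a3.
  have h2 := leq_trans h3 h32; rewrite (pow2_large _ h2) (pow2_large _ h3) => e.
  case: (@no_sum 0%num (N.of_nat n1) (N.of_nat n2)
    [:: N.of_nat (a1 - 13); N.of_nat (a2 - 13); N.of_nat (a3 - 13)]).
    exact: mem_head.
  rewrite e /rhs /=; lia.
have [h2|h2] := ltnP 12 a2.
  rewrite (pow2_large _ h2) => e.
  case: (@no_sum (2 ^ N.of_nat a3)%num (N.of_nat n1) (N.of_nat n2)
    [:: N.of_nat (a1 - 13); N.of_nat (a2 - 13)]).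
    rewrite inE mem_cat; apply/orP; right; apply/orP; left.
    by apply/mapP; exists a3; rewrite ?mem_pow.
  rewrite e /rhs /=; lia.
move=> e.
case: (@no_sum (2 ^ N.of_nat a2 + 2 ^ N.of_nat a3)%num (N.of_nat n1) (N.of_nat n2)
    [:: N.of_nat (a1 - 13)]).
  rewrite inE mem_cat; apply/orP; right; apply/orP; right.
  apply/mapP; eexists; last by [].
  apply/flatten_mapP; exists a2; first exact: mem_pow.
  by apply/mapP; exists a3; rewrite // mem_iota.
rewrite e /rhs /=; lia.
Qed.

(** * Finite enumeration of the remaining range *)

Lemma leq_fib m n : m <= n -> fib m <= fib n.
Proof.
move/subnK <-; elim: (n - m) => // k IH; rewrite addSn; apply: leq_trans IH _.
case: (k + m) => // j; exact: leq_addr.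
Qed.

Lemma sol_small n1 n2 a1 a2 a3 : is_sol n1 n2 a1 a2 a3 -> n1 <= 21.
Proof.
move=> sol; have h1 := no_large_sol _ _ _ _ _ sol.
case/and4P: sol => _ h32 h21 /eqP e; rewrite leqNgt; apply/negP => /leq_fib h.
(* [F_22 = 17711] exceeds [3 * 2 ^ 12 = 12288]. *)
have : fib 22 <= 2 ^ 12 + 2 ^ 12 + 2 ^ 12; last by vm_compute.
apply: leq_trans h _; apply: leq_trans (leq_addr (fib n2) _) _; rewrite e.
have h2 := leq_trans h21 h1; have h3 := leq_trans h32 h2.
by rewrite !leq_add // leq_exp2l.
Qed.

(** [fib_mod 0] is the exact value, because [x mod 0 = x] in [N]. *)
Definition fib_sums : seq (nat * nat * N) :=
  flatten [seq [seq (n1, n2, fib_mod 0 (N.of_nat n1) + fib_mod 0 (N.of_nat n2))%num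
    | n2 <- iota 0 n1.+1] | n1 <- iota 0 22].

Definition pow_triples : seq (nat * nat * nat * N) :=
  flatten [seq flatten [seq
    [seq (a1, a2, a3, 2 ^ N.of_nat a1 + 2 ^ N.of_nat a2 + 2 ^ N.of_nat a3)%num
      | a3 <- iota 0 a2.+1] | a2 <- iota 0 a1.+1] | a1 <- iota 0 13].

Definition solutions : seq (nat * nat * nat * nat * nat) :=
  flatten [seq [seq (u.1, w.1.1.1, w.1.1.2, w.1.2) | w <- pow_triples & N.eqb u.2 w.2]
    | u <- fib_sums].

Lemma mem_solutions n1 n2 a1 a2 a3 :
  is_sol n1 n2 a1 a2 a3 -> (n1, n2, a1, a2, a3) \in solutions.
Proof.
move=> sol; have [hn ha] := (sol_small _ _ _ _ _ sol, no_large_sol _ _ _ _ _ sol).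
case/and4P: sol => h12 h32 h21 /eqP e.
apply/flatten_mapP.
exists (n1, n2, (fib_mod 0 (N.of_nat n1) + fib_mod 0 (N.of_nat n2))%num).
  apply/flatten_mapP; exists n1; first by rewrite mem_iota.
  by apply/mapP; exists n2; rewrite // mem_iota.
apply/mapP.
exists (a1, a2, a3, (2 ^ N.of_nat a1 + 2 ^ N.of_nat a2 + 2 ^ N.of_nat a3)%num) => //.
rewrite mem_filter; apply/andP; split.
  apply/N.eqb_eq; rewrite /= !fib_modE !N.mod_0_r -!FE -!pow2E; lia.
apply/flatten_mapP; exists a1; first by rewrite mem_iota.
apply/flatten_mapP; exists a2; first by rewrite mem_iota.
by apply/mapP; exists a3; rewrite // mem_iota.
Qed.

Definition sound (t : nat * nat * nat * nat * nat) : bool :=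
  [&& is_sol t.1.1.1.1 t.1.1.1.2 t.1.1.2 t.1.2 t.2, t.1.1.1.1 <= 18 & t.1.1.2 <= 11].

(** The bounds 18 and 11, sharper than the enumerated range 21 and 12, are read off the computed
    list. *)
Lemma solutionsP : exists sols : seq (nat * nat * nat * nat * nat),
  [/\ uniq sols, size sols = 78, all sound sols & forall n1 n2 a1 a2 a3,
    is_sol n1 n2 a1 a2 a3 -> (n1, n2, a1, a2, a3) \in sols].
Proof.
exists solutions; split; last exact: mem_solutions; by vm_compute.
Qed.

Theorem theorem1p1 :
  (forall n1 n2 a1 a2 a3 : nat, is_sol n1 n2 a1 a2 a3 -> n1 <= 18 /\ a1 <= 11) /\
  #|[set t : 'I_19 * 'I_19 * 'I_12 * 'I_12 * 'I_12 |
      is_sol t.1.1.1.1 t.1.1.1.2 t.1.1.2 t.1.2 t.2]| = 78.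
Proof.
have [sols [uniq_sols size_sols /allP sols_ok mem_sols]] := solutionsP.
split=> [n1 n2 a1 a2 a3 /mem_sols/sols_ok/and3P[_ h18 h11] //|].
set S := [set t | _].
(* Forgetting the bounds turns the enumeration of [S] into a duplicate-free list of natural numbers,
   which is shown to be a permutation of [sols]. *)
pose f (t : 'I_19 * 'I_19 * 'I_12 * 'I_12 * 'I_12) : nat * nat * nat * nat * nat :=
  (val t.1.1.1.1, val t.1.1.1.2, val t.1.1.2, val t.1.2, val t.2).
have f_inj : injective f.
  move=> [[[[? ?] ?] ?] ?] [[[[? ?] ?] ?] ?] [] *.
  by repeat (congr (_, _); last exact: val_inj); apply: val_inj.
rewrite cardE -(size_map f) -size_sols; apply/perm_size/uniq_perm => //.
  by rewrite map_inj_uniq ?enum_uniq.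
move=> [[[[n1 n2] a1] a2] a3]; apply/mapP/idP => [[t] | hs].
  by rewrite mem_enum inE => sol ->; apply: mem_sols.
have /and3P[/= sol h18 h11] := sols_ok _ hs.
have /and4P[h12 h32 h21 _] := sol.
have [h2 h3] : n2 <= 18 /\ a3 <= 11 by lia.
exists (inord n1, inord n2, inord a1, inord a2, inord a3).
  by rewrite mem_enum inE /= !inordK //; lia.
by rewrite /f /= !inordK //; lia.
Qed.
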